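(* Let $k$ be a field and let $I=(m_1,\ldots,m_r)\subset k[\mathbf{y}]=k[y_1,\ldots,y_n]$ be a squarefree monomial ideal with minimal monomial generators $m_1,\ldots,m_r$, $r\ge 2$. Let $\hat L=LCM(I)$ and assume that $I$ has a linear resolution. If $\gcd\{m_1,\ldots,m_r\}=1$, then $I\cong M(L)$; that is, after discarding the variables $y_i$ that divide no generator of $I$, there is a bijection between the variables of $k[L]$ and the remaining variables $y_i$ that carries $M(L)$ to $I$.
   Context: For a monomial ideal $I$ with minimal monomial generators $f_1,\ldots,f_r$, $LCM(I)$ is the set of least common multiples of all subsets of $\{f_1,\ldots,f_r\}$ (the empty subset giving $1$), ordered by divisibility; it is a finite atomic lattice. For a finite atomic lattice $\hat L$ (every element is a join of atoms) with minimum $\hat 0$ and maximum $\hat 1$: $L=\hat L\setminus\{\hat 0,\hat 1\}$; $\operatorname{mi}(L)$ is the set of meet-irreducible elements of $L$, i.e. elements of $L$ covered by exactly one element of $\hat L$; $k[L]:=k[x_l: l\in\operatorname{mi}(L)]$; for $a\in\hat L$, $x(a):=\prod x_l$ over $l\in\operatorname{mi}(L)$ with $a\not\le l$; and the squarefree minimal ideal is $M(L):=(x(a): a\text{ an atom of }\hat L)$. A graded ideal $I$ has a linear resolution if there is $d$ such that the graded Betti numbers satisfy $\beta_{i,j}(I)=0$ unless $j=i+d$ (standard grading). *)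

(* Defs.v *)
From HB Require Import structures.
From mathcomp Require Import all_boot all_order all_algebra.
From mathcomp Require Import mpoly.
Set Implicit Arguments.
Unset Strict Implicit.
Unset Printing Implicit Defensive.
Import Order.TTheory GRing.Theory.
Local Open Scope ring_scope.

(* Monomials of k[y_1, ..., y_n] are exponent vectors u : 'X_{1..n}; the
   monomial 1 is 0%MM, and divisibility is (u <= v)%MM.  (The library's order
   (u <= v)%O on 'X_{1..n} is a monomial order and is not used here.) *)

Section Monomials.

Variable n : nat.
Implicit Types u v w : 'X_{1..n}.

Lemma mlcmA : associative (@mlcm n).
Proof. by move=> u v w; apply/mnmP=> i; rewrite !mnmE maxnA. Qed.

HB.instance Definition _ :=
  Monoid.isComLaw.Build 'X_{1..n} 0%MM (@mlcm n) mlcmA (@mlcmC n) (@mlc0m n).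

Lemma lem_anti u v : (u <= v)%MM -> (v <= u)%MM -> u = v.
Proof.
move=> /mnm_lepP uv /mnm_lepP vu; apply/mnmP=> i.
by apply/eqP; rewrite eqn_leq uv vu.
Qed.

Definition squarefree u : Prop := forall i, (u i <= 1)%N.

Section Family.

Variables (J : finType) (m : J -> 'X_{1..n}).

Definition lcm_of (A : {set J}) : 'X_{1..n} := \big[@mlcm n/0%MM]_(j in A) m j.

(* Starting the minimum from the maximal exponent has no effect on a nonempty
   family. *)
Definition gcd_of : 'X_{1..n} :=
  [multinom \big[minn/(\max_j m j i)%N]_j m j i | i < n].

(* No generator divides another one, and the family has no repetition. *)
Definition minimal_generators : Prop :=
  forall i j, (m i <= m j)%MM -> i = j.

Definition monomial_ideal (k : fieldType) (p : {mpoly k[n]}) : Prop :=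
  exists c : J -> {mpoly k[n]}, p = \sum_j c j * 'X_[m j].

Definition used_vars : {set 'I_n} := [set i | [exists j, (0 < m j i)%N]].

(* The same monomials, in the polynomial ring on the used variables only. *)
Definition discard_unused (j : J) : 'X_{1..#|used_vars|} :=
  [multinom m j (enum_val i) | i < #|used_vars|].

End Family.
End Monomials.

(** * The lattice LCM(I) *)

Definition lcm_seq n (J : finType) (m : J -> 'X_{1..n}) : seq 'X_{1..n} :=
  [seq lcm_of m A | A : {set J}].

Definition LCM n (J : finType) (m : J -> 'X_{1..n}) : Type :=
  seq_sub (lcm_seq m).

HB.instance Definition _ n (J : finType) (m : J -> 'X_{1..n}) :=
  Finite.copy (LCM m) (seq_sub (lcm_seq m)).

Fact LCM_display : Order.disp_t. Proof. exact: (Order.Disp tt tt). Qed.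

Section LCMLattice.

Variables (n : nat) (J : finType) (m : J -> 'X_{1..n}).
Implicit Types a b c : LCM m.

Definition mon_of a : 'X_{1..n} := ssval a.

Lemma mon_of_inj : injective mon_of. Proof. exact: val_inj. Qed.

Lemma lcm_seqP u : reflect (exists A, u = lcm_of m A) (u \in lcm_seq m).
Proof.
apply: (iffP mapP) => [[A _ ->]|[A ->]]; first by exists A.
by exists A; rewrite ?mem_enum.
Qed.

Lemma lem_lcm_of A u :
  (lcm_of m A <= u)%MM = [forall j in A, (m j <= u)%MM].
Proof.
rewrite /lcm_of -big_andE.
elim/big_rec2: _ => [|j b v _ <-]; first by apply/mnm_lepP=> i; rewrite mnmE.
exact: lem_mlcm.
Qed.

Lemma lcm_ofU A B : lcm_of m (A :|: B) = mlcm (lcm_of m A) (lcm_of m B).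
Proof.
have leP (C : {set J}) u : reflect (forall j, j \in C -> m j <= u)%MM (lcm_of m C <= u)%MM.
  by rewrite lem_lcm_of; apply: (iffP forall_inP).
apply: lem_anti.
  apply/leP=> j; rewrite inE => /orP[] jX.
    by apply: lepm_trans (lem_mlcml _ _); move/leP: (lepm_refl (lcm_of m A)); apply.
  by apply: lepm_trans (lem_mlcmr _ _); move/leP: (lepm_refl (lcm_of m B)); apply.
have /leP AB := lepm_refl (lcm_of m (A :|: B)).
by rewrite lem_mlcm; apply/andP; split; apply/leP=> j jX; apply: AB;
  rewrite inE jX ?orbT.
Qed.

Definition LCM_of (A : {set J}) : LCM m :=
  SeqSub (introT (lcm_seqP _) (ex_intro _ A erefl)).

Definition LCM_le a b := (mon_of a <= mon_of b)%MM.

Fact LCM_le_refl : reflexive LCM_le. Proof. by move=> a; apply: lepm_refl. Qed.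

Fact LCM_le_anti : antisymmetric LCM_le.
Proof. by move=> a b /andP[ab ba]; apply/mon_of_inj/lem_anti. Qed.

Fact LCM_le_trans : transitive LCM_le.
Proof. by move=> b a c; apply: lepm_trans. Qed.

HB.instance Definition _ := Order.Le_isPOrder.Build LCM_display (LCM m)
  LCM_le_refl LCM_le_anti LCM_le_trans.

Lemma LCM_leE a b : (a <= b)%O = (mon_of a <= mon_of b)%MM.
Proof. by []. Qed.

Definition gens_below a : {set J} := [set j | (m j <= mon_of a)%MM].

Definition LCM_join a b := LCM_of (gens_below a :|: gens_below b).
Definition LCM_meet a b := LCM_of (gens_below a :&: gens_below b).

Lemma gens_belowK a : lcm_of m (gens_below a) = mon_of a.
Proof.
apply: lem_anti; first by rewrite lem_lcm_of; apply/forall_inP=> j; rewrite inE.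
have /lcm_seqP[A eqA] := valP a; rewrite /= -/(mon_of a) in eqA.
rewrite {1}eqA lem_lcm_of; apply/forall_inP=> j jA.
have: (lcm_of m (gens_below a) <= lcm_of m (gens_below a))%MM by apply: lepm_refl.
rewrite {1}lem_lcm_of => /forall_inP; apply; rewrite inE eqA.
have := lepm_refl (lcm_of m A); rewrite {1}lem_lcm_of => /forall_inP.
exact.
Qed.

Lemma LCM_leS a b : (a <= b)%O = (gens_below a \subset gens_below b).
Proof.
apply/idP/subsetP => [ab j|sab]; first by rewrite !inE => ja; apply: lepm_trans ab.
rewrite LCM_leE -gens_belowK lem_lcm_of; apply/forall_inP=> j /sab.
by rewrite inE.
Qed.

Lemma gens_below_le A a : (LCM_of A <= a)%O = (A \subset gens_below a).
Proof.
rewrite LCM_leE /= lem_lcm_of.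
by apply/forall_inP/subsetP => H j /H; rewrite inE.
Qed.

Fact LCM_joinP a b c : (LCM_join a b <= c)%O = (a <= c)%O && (b <= c)%O.
Proof. by rewrite gens_below_le subUset !LCM_leS. Qed.

Fact LCM_meetP a b c : (a <= LCM_meet b c)%O = (a <= b)%O && (a <= c)%O.
Proof.
rewrite !LCM_leS -subsetI; apply/idP/idP=> H.
  apply: subset_trans H _; rewrite subsetI -!LCM_leS.
  by rewrite !gens_below_le subsetIl subsetIr.
by apply: subset_trans H _; rewrite -gens_below_le.
Qed.

HB.instance Definition _ :=
  Order.POrder_MeetJoin_isLattice.Build LCM_display (LCM m) LCM_meetP LCM_joinP.

Fact LCM_le0x a : (LCM_of set0 <= a)%O.
Proof. by rewrite gens_below_le sub0set. Qed.

Fact LCM_lex1 a : (a <= LCM_of setT)%O.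
Proof. by rewrite LCM_leS; apply: subset_trans (subsetT _) _; rewrite -gens_below_le. Qed.

HB.instance Definition _ := Order.hasBottom.Build LCM_display (LCM m) LCM_le0x.
HB.instance Definition _ := Order.hasTop.Build LCM_display (LCM m) LCM_lex1.

Lemma LCM_joinE a b : mon_of (a `|` b)%O = mlcm (mon_of a) (mon_of b).
Proof. by rewrite /= [LHS]lcm_ofU !gens_belowK. Qed.

Lemma LCM_bottomE : mon_of \bot%O = 0%MM.
Proof. by rewrite /mon_of /= /lcm_of big_set0. Qed.

End LCMLattice.

(** * The squarefree minimal ideal M(L) of a finite lattice *)

Section MinimalIdeal.

Context {disp : Order.disp_t}.
Variable L : finTBLatticeType disp.
Implicit Types a b : L.

Definition covers b a : bool :=
  (a < b)%O && [forall c : L, ~~ ((a < c)%O && (c < b)%O)].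

Definition atom a : bool := covers a \bot%O.

(* The argument L is the full lattice, with its \bot and \top, which mi
   excludes. *)
Definition mi : {set L} :=
  [set l | [&& l != \bot%O, l != \top%O & #|[set b | covers b l]| == 1%N]].

(* The variables of k[L] are numbered by the enumeration of mi. *)
Definition x_mon a : 'X_{1..#|mi|} :=
  [multinom nat_of_bool (~~ (a <= enum_val i)%O) | i < #|mi|].

Definition M_gen (a : {a : L | atom a}) : 'X_{1..#|mi|} := x_mon (val a).

Definition M_ideal (k : fieldType) : {mpoly k[#|mi|]} -> Prop :=
  monomial_ideal M_gen (k := k).

End MinimalIdeal.

(** * Graded Betti numbers and linear resolutions *)

(* A complex ... -> F_1 -> F_0 -> S of graded free modules over S = k[y], with
   F_i = S(-shift i 0) + ... + S(-shift i (rk i - 1)).  Elements of F_i are row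
   vectors, on which matrices act from the right; F_i may be 0. *)
Record graded_free_seq (k : fieldType) (n : nat) := GradedFreeSeq {
  rk : nat -> nat;
  shift : forall i, 'I_(rk i) -> nat;
  diff : forall i, 'M[{mpoly k[n]}]_(rk i.+1, rk i);
  aug : 'cV[{mpoly k[n]}]_(rk 0)
}.

(* The augmentation F_0 -> S has image I, the sequence is exact, all maps are
   homogeneous of degree 0, and F_(i+1) is mapped into (y_1, ..., y_n) F_i. *)
Record minimal_graded_resolution (k : fieldType) (n : nat)
    (I : {mpoly k[n]} -> Prop) (F : graded_free_seq k n) : Prop := {
  aug_homog : forall a, aug F a 0 \is (shift a).-homog;
  diff_homog : forall i a b, diff F i a b != 0 ->
    exists2 e, shift a = (shift b + e)%N & diff F i a b \is e.-homog;
  diff_minimal : forall i a b, (diff F i a b)@_0%MM = 0;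
  aug_image : forall p, I p <-> exists v : 'rV_(rk F 0), p = (v *m aug F) 0 0;
  aug_exact : forall v : 'rV_(rk F 0),
    v *m aug F = 0 <-> exists w : 'rV_(rk F 1), v = w *m diff F 0;
  diff_exact : forall i (v : 'rV_(rk F i.+1)),
    v *m diff F i = 0 <-> exists w : 'rV_(rk F i.+2), v = w *m diff F i.+1
}.

(* When F is a minimal graded free resolution of I, this is the graded Betti
   number beta_(i,j)(I), as such a resolution is unique up to isomorphism. *)
Definition betti (k : fieldType) n (F : graded_free_seq k n) (i j : nat) : nat :=
  #|[set a : 'I_(rk F i) | shift a == j]|.

Definition has_linear_resolution (k : fieldType) n
    (I : {mpoly k[n]} -> Prop) : Prop :=
  exists2 F, minimal_graded_resolution I F &
    exists d, forall i j, j <> (i + d)%N -> betti F i j = 0%N.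

(* The k-algebra morphism sending the variable i to the variable s i. *)
Definition rename_vars (k : fieldType) (n p : nat) (s : 'I_n -> 'I_p)
    (q : {mpoly k[n]}) : {mpoly k[p]} :=
  q \mPo [tuple 'X_(s i) | i < n].

(* Main.v *)
(* For a variable y_i let l_i be the lcm of the generators that y_i does not
   divide.  Then l_i is the largest element of LCM(I) not divisible by y_i, and,
   since the generators are squarefree, every meet-irreducible element is some
   l_i.  Linearity of the first syzygies connects the generators divisible by y_i
   with those that are not: some generator divisible by y_i divides y_i m_b for
   a generator m_b prime to y_i.  Hence y_i l_i lies in LCM(I) and is the
   only cover of l_i, so that l_i is meet-irreducible and determines y_i. *)
Require Import Defs.
From mathcomp Require Import all_boot all_order all_algebra.
From mathcomp Require Import mpoly.
Set Implicit Arguments.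
Unset Strict Implicit.
Unset Printing Implicit Defensive.
Local Open Scope ring_scope.
Import Order.TTheory GRing.Theory.

(** * Restricting polynomials to a set of monomials *)

Section Support.

Variables (k : fieldType) (n : nat) (Q : pred 'X_{1..n}).
Implicit Types p q : {mpoly k[n]}.

Definition mpart p : {mpoly k[n]} :=
  \sum_(u <- msupp p | Q u) p@_u *: 'X_[u].

Lemma mcoeff_mpart p u : (mpart p)@_u = if Q u then p@_u else 0.
Proof.
rewrite /mpart raddf_sum /=.
under eq_bigr => v _ do rewrite mcoeffZ mcoeffX.
have [up|up] := boolP (u \in msupp p); last first.
  rewrite (memN_msupp_eq0 up) if_same big_seq_cond big1 // => v /andP[vp _].
  by case: eqP => [vu|_]; [rewrite -vu vp in up | rewrite mulr0].
case: ifP => Qu; last first.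
  rewrite big1 // => v Qv; case: eqP => [vu|_]; last by rewrite mulr0.
  by rewrite -vu Qv in Qu.
rewrite (big_rem u) //= Qu eqxx mulr1 big_seq_cond big1 ?addr0 // => v /andP[].
rewrite mem_rem_uniq ?msupp_uniq // inE => /andP[/negPf -> _] _.
by rewrite mulr0.
Qed.

Lemma msupp_mpart p : msupp (mpart p) =i [pred u in msupp p | Q u].
Proof.
move=> u; rewrite inE !mcoeff_msupp mcoeff_mpart.
by case: ifP; rewrite ?andbT ?andbF ?eqxx.
Qed.

(** Each monomial of [c a * g a] is a multiple of a monomial of [g a]. Used with [Q] a monomial
    ideal and with [Q] a lower bound on the degree. *)
Lemma msupp_lincomb (I : finType) (c g : I -> {mpoly k[n]}) :
    (forall u v, (u <= v)%MM -> Q u -> Q v) ->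
    (forall a u, u \in msupp (g a) -> Q u) ->
  forall u, u \in msupp (\sum_a c a * g a) -> Q u.
Proof.
move=> Qup Qg u /msupp_sum_le /flatten_mapP[a _].
move=> /msuppM_le /allpairsP[[v w] [_ /= /Qg Qw ->]].
exact: Qup (lem_addl _ _) Qw.
Qed.

End Support.

(** * First syzygies of a linear resolution *)

Section LinearSyzygies.

Variables (k : fieldType) (n : nat) (J : finType) (m : J -> 'X_{1..n}).
Variables (F : graded_free_seq k n) (d : nat).
Hypothesis m_min : minimal_generators m.
Hypothesis F_res : minimal_graded_resolution (monomial_ideal m (k := k)) F.
Hypothesis F_lin : forall i j, j <> (i + d)%N -> betti F i j = 0%N.

Lemma linear_shift i (a : 'I_(rk F i)) : shift a = (i + d)%N.
Proof.
apply/eqP/negPn/negP => /eqP /F_lin /eqP.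
by rewrite cards_eq0 => /eqP/setP/(_ a); rewrite !inE eqxx.
Qed.

Definition family_ideal (C : pred J) : pred 'X_{1..n} :=
  fun u => [exists j, C j && (m j <= u)%MM].

Lemma family_idealS C u v :
  (u <= v)%MM -> family_ideal C u -> family_ideal C v.
Proof.
move=> uv /existsP[j /andP[Cj ju]]; apply/existsP; exists j.
by rewrite Cj (lepm_trans ju uv).
Qed.

(** By minimality, [m j] is the only generator dividing [m j]. *)
Lemma family_ideal_gen C j : family_ideal C (m j) = C j.
Proof.
apply/existsP/idP => [[j' /andP[Cj' /m_min <-]] //|Cj].
by exists j; rewrite Cj lepm_refl.
Qed.

(** The entry is the image of a basis vector of [F_0], whose degree is [d] by linearity. *)
Lemma aug_supp a u :
  u \in msupp (aug F a 0) -> family_ideal predT u /\ mdeg u = d.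
Proof.
move=> ua; split; last first.
  by have /dhomogP/(_ _ ua) := aug_homog F_res a; rewrite linear_shift.
have [c Ec] : monomial_ideal m (aug F a 0).
  apply/(aug_image F_res); exists (delta_mx 0 a).
  by rewrite -rowE mxE.
rewrite Ec in ua; move: u ua; apply: msupp_lincomb => [v w|j v]; first exact: family_idealS.
by rewrite msuppX inE => /eqP ->; rewrite family_ideal_gen.
Qed.

Lemma gen_aug j : exists v : 'rV_(rk F 0), 'X_[m j] = (v *m aug F) 0 0.
Proof.
apply/(aug_image F_res); exists (fun j' => (j' == j)%:R).
rewrite (bigD1 j) //= eqxx mul1r big1 ?addr0 // => j' /negPf ->.
by rewrite mul0r.
Qed.

(** [m j] is a combination of entries of the augmentation, whose monomials all have degree [d]. *)
Lemma gen_degree j : (d <= mdeg (m j))%N.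
Proof.
have [v] := gen_aug j; rewrite mxE => Ev.
have : m j \in msupp (\sum_a v 0 a * aug F a 0) by rewrite -Ev msuppX inE.
apply: (msupp_lincomb (Q := fun u => d <= mdeg u)%N) => [u w|a u /aug_supp[_ ->] //].
by move=> uw /leq_trans; apply; rewrite -(submK uw) mdegD leq_addl.
Qed.

(* If no generator in C and no generator outside C divide a common monomial of
   degree d + 1, then taking the C-parts of the entries of the augmentation
   preserves the linear syzygies, hence all syzygies; but it does not preserve
   the Koszul syzygy between a generator in C and one outside C. *)
Lemma linear_connected (C : pred J) b c : ~~ C b -> C c ->
  exists j j' u, [/\ C j, ~~ C j', mdeg u = d.+1,
    (m j <= u)%MM & (m j' <= u)%MM].
Proof.
move=> Cb Cc.
pose Q := family_ideal C; pose Q' := family_ideal (predC C).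
pose g := \col_a mpart Q (aug F a 0); pose h := aug F - g.
have Qg a u : u \in msupp (g a 0) -> Q u.
  by rewrite mxE msupp_mpart => /andP[].
have gdeg a u : u \in msupp (g a 0) -> mdeg u = d.
  by rewrite mxE msupp_mpart => /andP[/aug_supp[]].
have Q'h a u : u \in msupp (h a 0) -> Q' u.
  rewrite mcoeff_msupp 3!mxE mcoeffB mcoeff_mpart.
  case: ifP => [|Qu]; first by rewrite subrr eqxx.
  rewrite subr0 -mcoeff_msupp => /aug_supp[/existsP[j /= ju] _].
  apply/existsP; exists j; rewrite ju andbT /=; apply: contraFN Qu => Cj.
  by apply/existsP; exists j; rewrite Cj.
have Qlin (v : 'rV_(rk F 0)) u : u \in msupp ((v *m g) 0 0) -> Q u.
  by rewrite mxE; apply: msupp_lincomb u => // u w; apply: family_idealS.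
have Q'lin (v : 'rV_(rk F 0)) u : u \in msupp ((v *m h) 0 0) -> Q' u.
  by rewrite mxE; apply: msupp_lincomb u => // u w; apply: family_idealS.
have [exch|noexch] := boolP [forall e, (row e (diff F 0) *m g) 0 0 == 0]; last first.
  move: noexch; rewrite negb_forall => /existsP[e].
  set D := row e _; rewrite -msupp_eq0.
  case Emu: (msupp _) => [//|u us] _.
  have u_in : u \in msupp ((D *m g) 0 0) by rewrite Emu mem_head.
  (* As [D] is a syzygy, [D *m h] is the negative of [D *m g]: the monomial [u] occurs in both,
     hence lies in both ideals. *)
  have DF : D *m aug F = 0.
    by apply/(aug_exact F_res); exists (delta_mx 0 e); rewrite -rowE.
  have u_in' : u \in msupp ((D *m h) 0 0).
    by rewrite mulmxBr DF sub0r mxE (perm_mem (msuppN _)).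
  have /existsP[j /andP[Cj ju]] := Qlin _ _ u_in.
  have /existsP[j' /andP[Cj' ju']] := Q'lin _ _ u_in'.
  exists j, j', u; split=> //.
  move: u_in; rewrite mxE => /msupp_sum_le /flatten_mapP[a _].
  move=> /msuppM_le /allpairsP[[v w] [/= vD /gdeg wd ->]].
  (* Nonzero entries of [diff F 0] are linear forms, the shifts being [1 + d] and [d]. *)
  rewrite mdegD wd -add1n; congr (_ + _)%N.
  have D0 : diff F 0 e a != 0.
    by apply: contraTneq vD => D0; rewrite mxE D0 msupp0.
  have [s + /dhomogP hom] := diff_homog F_res D0.
  rewrite !linear_shift add0n addnC => /addnI ->.
  by apply: hom; move: vD; rewrite mxE.
have syz (v : 'rV_(rk F 0)) : v *m aug F = 0 -> (v *m g) 0 0 = 0.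
  move=> /(aug_exact F_res)[w ->]; rewrite -mulmxA mxE big1 // => e _.
  have /eqP := forallP exch e; rewrite -row_mul mxE => ->.
  by rewrite mulr0.
have [v Ev] := gen_aug c; have [w Ew] := gen_aug b.
(* The Koszul syzygy: [v] and [w] lift the monomials [m c] and [m b] to [F_0]. *)
have /syz : ('X_[m b] *: v - 'X_[m c] *: w) *m aug F = 0.
  rewrite mulmxBl -!scalemxAl [v *m _]mx11_scalar [w *m _]mx11_scalar -Ev -Ew.
  by rewrite !scale_scalar_mx mulrC subrr.
rewrite mulmxBl -!scalemxAl [v *m _]mx11_scalar [w *m _]mx11_scalar.
rewrite !scale_scalar_mx -raddfB [LHS]mxE mulr1n.
(* At [m b + m c] the first product contributes the coefficient of [v *m g] at [m c], which is 1,
   and the second that of [w *m g] at [m b], which is 0; so 1 = 0. *)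
move=> /(congr1 (mcoeff (m b + m c)%MM)); rewrite mcoeff0 mcoeffB.
rewrite [_ * (v *m g) 0 0]mulrC mcoeffMX [(m b + m c)%MM]addmC.
rewrite [_ * (w *m g) 0 0]mulrC mcoeffMX.
have -> : ((w *m g) 0 0)@_(m b) = 0.
  apply/eqP; rewrite mcoeff_eq0; apply/negP => /Qlin.
  by rewrite [Q _]family_ideal_gen (negPf Cb).
have vh0 : ((v *m h) 0 0)@_(m c) = 0.
  apply/eqP; rewrite mcoeff_eq0; apply/negP => /Q'lin.
  by rewrite [Q' _]family_ideal_gen /= Cc.
have : ((v *m aug F) 0 0)@_(m c) = 1 by rewrite -Ev mcoeffX eqxx.
have -> : aug F = g + h by rewrite addrC subrK.
rewrite mulmxDr mxE mcoeffD vh0 addr0 => ->.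
by rewrite subr0 => /eqP; rewrite oner_eq0.
Qed.

(** Take for [C] the generators divisible by [y_i]. The common multiple [u] has degree [d.+1] and
    [m j'] has degree at least [d], so [u] is [m j'] times at most one variable; this is [y_i],
    which divides [m j] but not [m j']. *)
Lemma linear_exchange i b c : m b i = 0%N -> (0 < m c i)%N ->
  exists j j', [/\ (0 < m j i)%N, m j' i = 0%N & (m j <= m j' + U_(i))%MM].
Proof.
move=> bi ci.
have Cb : ~~ (0 < m b i)%N by rewrite bi.
have [j [j' [u [ji]]]] := @linear_connected (fun j => 0 < m j i)%N b c Cb ci.
rewrite -eqn0Ngt => /eqP j'i degu ju j'u.
exists j, j'; split=> //; apply: (lepm_trans ju).
have := submK j'u; set v := (u - m j')%MM => Eu.
have vi : (0 < v i)%N.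
  by rewrite mnmBE j'i subn0; apply: leq_trans ji (mnm_lepP ju i).
have Uv : (U_(i) <= v)%MM by rewrite lep1mP -lt0n.
have vdeg : (mdeg v <= 1)%N.
  by rewrite -(leq_add2r d) add1n -degu -Eu mdegD leq_add2l gen_degree.
move: vdeg; rewrite -(submK Uv) mdegD mdeg1 -[X in (_ <= X)%N]add0n leq_add2r leqn0.
rewrite mdeg_eq0 => /eqP v0.
by rewrite -Eu -(submK Uv) v0 add0m addmC lepm_refl.
Qed.

End LinearSyzygies.

(** Among the elements above [a] and up to [b], one with the fewest elements below it covers [a]. *)
Lemma exists_cover disp (L : finTBLatticeType disp) (a b : L) :
  (a < b)%O -> exists2 c, covers c a & (c <= b)%O.
Proof.
move=> ab; have Pb : (a < b <= b)%O by rewrite ab lexx.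
case: (arg_minnP (P := fun c => a < c <= b)%O (fun c => #|[set x | x <= c]%O|) Pb).
move=> c /andP[ac cb] cmin; exists c => //; rewrite /covers ac.
apply/forallP => x; apply/negP => /andP[ax xc].
have := cmin x; rewrite ax (le_trans (ltW xc) cb) => /(_ isT).
rewrite leqNgt => /negP; apply; apply/proper_card/properP; split.
  by apply/subsetP => y; rewrite !inE => /le_trans -> //; apply: ltW.
by exists c; rewrite inE ?lexx // lt_geF.
Qed.

(** * Meet-irreducibles and atoms of the lcm-lattice *)

Section LatticeLCM.

Variables (n : nat) (J : finType) (m : J -> 'X_{1..n}).
Implicit Types (i : 'I_n) (a b c l : LCM m) (j : J).

Lemma lcm_ofE (A : {set J}) i : lcm_of m A i = (\max_(j in A) m j i)%N.
Proof.
apply: (big_morph (fun u : 'X_{1..n} => u i)) => [u v|]; first exact: mnmE.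
by rewrite mnmE.
Qed.

Lemma mon_of_gen j : mon_of (LCM_of m [set j]) = m j.
Proof. exact: big_set1. Qed.

(* The element l_i of the header. *)
Definition avoid i : LCM m := LCM_of m [set j | m j i == 0%N].

(** A generator dividing a monomial prime to [y_i] is itself prime to [y_i], hence is one of those
    whose lcm is [avoid i]. *)
Lemma le_avoid a i : (a <= avoid i)%O = (mon_of a i == 0%N).
Proof.
have avoid_i : mon_of (avoid i) i = 0%N.
  rewrite [LHS]lcm_ofE; apply: big1 => j.
  by rewrite inE => /eqP.
apply/idP/eqP => [|ai].
  by rewrite LCM_leE => /mnm_lepP/(_ i); rewrite avoid_i leqn0 => /eqP.
rewrite LCM_leE -gens_belowK lem_lcm_of; apply/forall_inP => j.
rewrite inE => /mnm_lepP/(_ i); rewrite ai leqn0 => mji.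
have := lepm_refl (mon_of (avoid i)); rewrite {1}[mon_of _]/(lcm_of _ _) lem_lcm_of.
by move/forall_inP; apply; rewrite inE.
Qed.

Lemma avoidE i : mon_of (avoid i) i = 0%N.
Proof. by apply/eqP; rewrite -le_avoid lexx. Qed.

(** Let [b] be the only cover of [l]. By squarefreeness some [y_i] divides [b] but not [l], so [l]
    is below [avoid i]. If it were strictly below, a cover of [l] below [avoid i] would have to be
    [b], which [y_i] divides. *)
Lemma mi_avoid l : (forall j, squarefree (m j)) -> l \in mi (LCM m) ->
  exists2 i, i \in used_vars m & l = avoid i.
Proof.
move=> m_sqf; rewrite inE => /and3P[_ _ /cards1P[b Eb]].
have covl c : covers c l = (c == b) by move/setP/(_ c): Eb; rewrite !inE.
have lb : (l < b)%O by have := covl b; rewrite eqxx => /andP[].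
have [i bi li] : exists2 i, mon_of b i != 0%N & mon_of l i = 0%N.
  have /negbT := lt_geF lb.
  rewrite LCM_leE negb_forall => /existsP[i]; rewrite -ltnNge => lbi.
  have bi : (mon_of b i <= 1)%N.
    rewrite -gens_belowK lcm_ofE; apply/bigmax_leqP => j _; exact: m_sqf.
  exists i; first by rewrite -lt0n (leq_ltn_trans _ lbi).
  by apply/eqP; rewrite -leqn0 -ltnS (leq_trans lbi bi).
exists i.
  move: bi; apply: contraR; rewrite inE negb_exists => /forallP mi0.
  rewrite -gens_belowK lcm_ofE big1 // => j _.
  by have := mi0 j; rewrite -eqn0Ngt => /eqP.
have := le_avoid l i; rewrite li eqxx le_eqVlt => /orP[/eqP //|].
case/exists_cover => c; rewrite covl => /eqP ->.
by rewrite le_avoid (negPf bi).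
Qed.

(** [m j] is not below [avoid i'], so [y_i'] divides it and hence divides [avoid i] times [y_i]. As
    [avoid i = avoid i'] is prime to [y_i'], the two variables agree. *)
Lemma avoid_inj i i' j : (0 < m j i)%N ->
  (m j <= mon_of (avoid i) + U_(i))%MM -> avoid i = avoid i' -> i = i'.
Proof.
move=> ji /mnm_lepP/(_ i') + Eii'.
rewrite mnmDE mnm1E [in X in X -> _]Eii' avoidE add0n => ji'.
have : ~~ (LCM_of m [set j] <= avoid i')%O.
  by rewrite -Eii' le_avoid mon_of_gen -lt0n.
rewrite le_avoid mon_of_gen -lt0n => /leq_trans/(_ ji').
by case: eqP.
Qed.

(** The join of [avoid i] and [m j] is the least element strictly above [avoid i]: any such element
    is divisible by [y_i], hence by [m j]. The generator [m j0] keeps [avoid i] away from [\bot]. *)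
Lemma avoid_mi i j j0 : (0 < m j i)%N ->
    (m j <= mon_of (avoid i) + U_(i))%MM -> m j0 i = 0%N -> m j0 != 0%MM ->
  avoid i \in mi (LCM m).
Proof.
move=> ji jle j0i j0N; set l := avoid i.
pose c := (l `|` LCM_of m [set j])%O.
have lc : (l < c)%O.
  rewrite lt_leAnge leUl le_avoid LCM_joinE mnmE mon_of_gen.
  by rewrite -lt0n leq_max ji orbT.
have cmin x : (l < x)%O -> (c <= x)%O.
  move=> lx; rewrite leUx (ltW lx) LCM_leE mon_of_gen.
  have xi : (0 < mon_of x i)%N by rewrite lt0n -le_avoid lt_geF.
  apply/mnm_lepP => i'; apply: leq_trans (mnm_lepP jle i') _.
  rewrite mnmDE mnm1E; have [<-|_] := eqVneq i i'; first by rewrite avoidE.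
  by rewrite addn0; move: (ltW lx); rewrite LCM_leE => /mnm_lepP.
rewrite inE; apply/and3P; split.
- have : (LCM_of m [set j0] <= l)%O by rewrite le_avoid mon_of_gen j0i.
  apply: contraTneq => ->; rewrite lex0; apply: contra j0N => /eqP j0b.
  by rewrite -mon_of_gen j0b LCM_bottomE.
- by rewrite -ltx1 (lt_le_trans lc) ?lex1.
apply/cards1P; exists c; apply/setP => x; rewrite !inE.
apply/andP/eqP => [[lx /forallP/(_ c)]|->].
  by rewrite lc /= lt_neqAle cmin // andbT negbK => /eqP.
split=> //; apply/forallP => x'; apply/negP => /andP[/cmin cx' /lt_geF].
by rewrite cx'.
Qed.

Hypotheses (m_min : minimal_generators m) (m_nz : forall j, m j != 0%MM).

Lemma gen_below a : a != \bot%O -> exists j, (LCM_of m [set j] <= a)%O.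
Proof.
move=> aN; have [a0|[j]] := set_0Vmem (gens_below a); last first.
  by rewrite inE; exists j; rewrite LCM_leE mon_of_gen.
case/eqP: aN; apply: mon_of_inj.
by rewrite -gens_belowK a0 LCM_bottomE [LHS]big_set0.
Qed.

(** Distinct generators are incomparable, and every element other than [\bot] lies above a
    generator. *)
Lemma atomP a : reflect (exists j, a = LCM_of m [set j]) (atom a).
Proof.
have genN j : LCM_of m [set j] != \bot%O.
  by apply: contra (m_nz j) => /eqP jb; rewrite -mon_of_gen jb LCM_bottomE.
apply: (iffP andP) => [[a0 /forallP amin]|[j ->]].
  have [|j ja] := gen_below (a := a); first by rewrite gt_eqF.
  exists j; apply/eqP; have := amin (LCM_of m [set j]).
  by rewrite lt0x genN /= lt_neqAle ja andbT negbK eq_sym.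
rewrite lt0x genN; split=> //; apply/forallP => c; rewrite lt0x.
apply/negP => /andP[/gen_below[j' j'c] cj].
have := le_lt_trans j'c cj; rewrite lt_neqAle LCM_leE !mon_of_gen.
by case/andP => /eqP j'j /m_min j'j0; rewrite j'j0 in j'j.
Qed.

End LatticeLCM.

(** * Renaming variables along a bijection *)

Section RenameVars.

Variables (k : fieldType) (n p : nat) (s : 'I_n -> 'I_p) (t : 'I_p -> 'I_n).
Hypotheses (sK : cancel s t) (tK : cancel t s).

Lemma rename_varsX (u : 'X_{1..n}) (w : 'X_{1..p}) :
  (forall i, w (s i) = u i) -> rename_vars s 'X_[k, u] = 'X_[w].
Proof.
move=> wu; rewrite /rename_vars comp_mpolyX mpolyXE_id (reindex s) /=; last first.
  by exists t => i _.
by apply: eq_bigr => i _; rewrite tnth_mktuple wu.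
Qed.

Lemma rename_vars_ideal (J J' : finType) (m : J -> 'X_{1..n})
    (m' : J' -> 'X_{1..p}) (q : {mpoly k[n]}) :
    (forall j, exists j', forall i, m' j' (s i) = m j i) ->
  monomial_ideal m q -> monomial_ideal m' (rename_vars s q).
Proof.
move=> mm' [c ->]; have {mm'} [f fP] := fin_all_exists mm'.
(* Several [j] may have the same image under [f]; their coefficients are added. *)
exists (fun j' => \sum_(j | f j == j') rename_vars s (c j)).
rewrite /rename_vars raddf_sum /= (partition_big f predT) //=.
apply: eq_bigr => j' _; rewrite mulr_suml; apply: eq_bigr => j /eqP <-.
by rewrite rmorphM /= [X in _ * X](rename_varsX (fP j)).
Qed.

End RenameVars.

Lemma rename_varsK (k : fieldType) n p (s : 'I_n -> 'I_p) (t : 'I_p -> 'I_n) :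
  cancel s t -> cancel t s ->
  cancel (@rename_vars k _ _ s) (@rename_vars k _ _ t).
Proof.
move=> sK tK q; rewrite /rename_vars [q \mPo _]comp_mpolyEX raddf_sum [RHS]mpolyE.
apply: eq_bigr => u _; rewrite [LHS]comp_mpolyZ; congr (_ *: _).
pose w := [multinom u (t i) | i < p].
have su : rename_vars s 'X_[k, u] = 'X_[w].
  by apply: (rename_varsX _ sK tK) => i; rewrite mnmE sK.
rewrite -/(rename_vars s 'X_[u]) su.
by apply: (rename_varsX _ tK sK) => i; rewrite mnmE.
Qed.

Theorem corollary5p9 (k : fieldType) (n r : nat) (m : 'I_r -> 'X_{1..n})
    (r_ge2 : (2 <= r)%N)
    (m_sqf : forall j, squarefree (m j))
    (m_min : minimal_generators m)
    (I_lin : has_linear_resolution (monomial_ideal m (k := k)))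
    (m_gcd : gcd_of m = 0%MM) :
  exists2 s : 'I_#|mi (LCM m)| -> 'I_#|used_vars m|,
    bijective s &
    forall q : {mpoly k[#|used_vars m|]},
      monomial_ideal (discard_unused m) q <->
      exists2 p : {mpoly k[#|mi (LCM m)|]},
        M_ideal p & q = rename_vars s p.
Proof.
have m_nz j : m j != 0%MM.
  (* A generator equal to 1 divides all the others, so [j] would equal two distinct indices. *)
  apply/eqP => mj0; pose j0 := Ordinal (ltnW r_ge2); pose j1 := Ordinal r_ge2.
  have le j' : j = j' by apply: m_min; rewrite mj0; apply/mnm_lepP => i; rewrite mnmE.
  by have := etrans (esym (le j0)) (le j1).
have coprime i : exists j, m j i = 0%N.
  suff /existsP[j /eqP ji] : [exists j, m j i == 0%N] by exists j.
  apply: contraTT isT; rewrite negb_exists => /forallP m_i.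
  have mi_gt0 j : (0 < m j i)%N by rewrite lt0n; apply: m_i.
  move/mnmP/(_ i): m_gcd; rewrite !mnmE => /eqP; rewrite -leqn0 leqNgt => /negP[].
  (* The minimum in [gcd_of] starts from the maximal exponent, which must be shown positive too; any
     index serves for this. *)
  elim/big_ind: _ => // [|u v]; last by rewrite leq_min => ->.
  by apply: leq_trans (leq_bigmax (Ordinal r_ge2)).
(* The exchange bounds [m j] by [m j' + U_(i)] with [m j'] prime to [y_i], hence below [avoid i]. *)
have exch i : i \in used_vars m ->
    exists2 j, (0 < m j i)%N & (m j <= mon_of (avoid m i) + U_(i))%MM.
  rewrite inE => /existsP[c ci]; have [b bi] := coprime i.
  have [F F_res [d F_lin]] := I_lin.
  have [j [j' [ji j'i jj']]] := linear_exchange m_min F_res F_lin bi ci.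
  exists j => //; apply: lepm_trans jj' _.
  have : (LCM_of m [set j'] <= avoid m i)%O by rewrite le_avoid mon_of_gen j'i.
  rewrite LCM_leE mon_of_gen => /mnm_lepP le'; apply/mnm_lepP => i'.
  by rewrite !mnmDE leq_add2r.
have avoidP (i : 'I_#|used_vars m|) : avoid m (enum_val i) \in mi (LCM m).
  have [j ji jle] := exch _ (enum_valP i); have [j0 j0i] := coprime (enum_val i).
  exact: avoid_mi ji jle j0i (m_nz j0).
(* The bijection is built backwards, sending [y_i] to [avoid i], and then inverted. *)
pose t (i : 'I_#|used_vars m|) := enum_rank_in (avoidP i) (avoid m (enum_val i)).
have tE i : enum_val (t i) = avoid m (enum_val i) by rewrite enum_rankK_in.
have t_inj : injective t.
  move=> i i' /(congr1 enum_val); rewrite !tE => Eii'.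
  have [j ji jle] := exch _ (enum_valP i).
  exact: enum_val_inj (avoid_inj ji jle Eii').
have t_surj l : exists i, t i = l.
  have [i i_used li] := mi_avoid m_sqf (enum_valP l).
  exists (enum_rank_in i_used i); apply: enum_val_inj.
  by rewrite tE enum_rankK_in.
have [s tK] := fin_all_exists t_surj.
have sK : cancel t s by move=> i; apply: t_inj; rewrite tK.
exists s; first by exists t.
(* [y_i] divides [m j] exactly when [m j] is not below [avoid i]; squarefreeness turns this into an
   equality of exponents. *)
have s_mon j l : discard_unused m j (s l) = x_mon (LCM_of m [set j]) l.
  rewrite !mnmE -{2}(tK l) tE le_avoid mon_of_gen.
  by case: (m j _) (m_sqf j (enum_val (s l))) => [|[]].
have atom_gen j : atom (LCM_of m [set j]) by apply/atomP => //; exists j.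
(* The atoms are exactly the generators, so by [s_mon] both renamings send generators to
   generators. *)
move=> q; split=> [Iq|[p Mp ->]].
  exists (rename_vars t q); last by rewrite rename_varsK.
  apply: (rename_vars_ideal sK tK) Iq => j; exists (Sub _ (atom_gen j)) => i.
  by rewrite /M_gen /= -s_mon sK.
apply: (rename_vars_ideal tK sK) Mp => -[a /= a_atom].
have /atomP[//|//|j Ej] := a_atom; exists j => l.
by rewrite s_mon /M_gen /= -Ej.
Qed.
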